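(* Assume the following. (1) ($L$-smoothness and lower bound) There is a constant $L>0$ such that for every $k\in\{1,\dots,q\}$ and all $x,x'\in\mathbb{R}^n$, $\|\nabla f_k(x)-\nabla f_k(x')\|\le L\|x-x'\|$; and $F^*:=\inf_{x\in\mathbb{R}^n}F_m(x)\in\mathbb{R}$. (2) (Unbiasedness and bounded gradient) There is a constant $\sigma\ge 0$ such that for every $k\in\{1,\dots,q\}$ and every $x\in\mathbb{R}^n$, $\mathbb{E}_\xi[\nabla g_k(x,\xi)]=\nabla f_k(x)$ and $\mathbb{E}_\xi[\|\nabla g_k(x,\xi)\|^2]\le\sigma^2$. (3) (Convexity and bounded iterates) Each $f_k$, $k\in\{1,\dots,q\}$, is convex, a minimizer $x^*\in\arg\min_{x}F_m(x)$ exists, and there is a constant $\Delta$ such that $\|x^{t,0,0}-x^*\|\le\Delta$ for every outer iteration $t$ of the Block-SMOO algorithm. Let $T\ge1$ be an integer, run the Block-SMOO algorithm for $T$ outer iterations with step size $\alpha_t=1/\sqrt{T}$ for all $t=0,\dots,T-1$, and let the output be $\bar{x}=\frac1T\sum_{t=0}^{T-1}x^{t,0,0}$. Then $$\mathbb{E}[F_m(\bar{x})-F^*]\le\frac{\|x^{0,0,0}-x^*\|^2+sp\,\sigma\left[\sigma+(\Delta L+\sigma)sp\right]}{2p\sqrt{T}}.$$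
   Context: Setting. Let $f_1,\dots,f_q:\mathbb{R}^n\to\mathbb{R}$ be continuously differentiable, $f_k(x)=\mathbb{E}[g_k(x,\xi)]$, where $\xi$ is a random variable and $\nabla g_k(x,\xi)$ is the gradient in $x$ of $g_k$ (the stochastic gradient). $\mathbb{E}_\xi$ denotes expectation with respect to $\xi$ (conditional on everything else), and $\|\cdot\|$ is the Euclidean norm. The variable $x\in\mathbb{R}^n$ is partitioned into $s\ge1$ disjoint blocks $x=(x_1,\dots,x_s)$, with $x_i\in\mathbb{R}^{n_i}$ and $\sum_{i=1}^s n_i=n$; $\nabla_i$ denotes the partial gradient with respect to block $x_i$. Let $m=(m_1,\dots,m_q)\in\mathbb{N}^q$ be a frequency vector of nonnegative integers and $p=\sum_{k=1}^q m_k\ge1$. The weighted-sum function is $F_m(x)=\sum_{k=1}^q\frac{m_k}{p}f_k(x)$. Block-SMOO algorithm. Input: a (deterministic) initial point $x^{0,0,0}\in\mathbb{R}^n$, positive step sizes $\{\alpha_t\}$, $p$ and $m$. For $t=0,\dots,T-1$: choose a permutation $\tau$ of $\{1,\dots,s\}$ (it may depend on $t$). For $i=0,\dots,s-1$: choose a map $\pi:\{0,\dots,p-1\}\to\{1,\dots,q\}$ with $|\pi^{-1}(k)|=m_k$ for all $k$ (it may depend on $t,i$). For $j=0,\dots,p-1$: generate a sample $\xi^{t,i,j}$ and set $$x^{t,i,j+1}_{\tau(i+1)}=x^{t,i,j}_{\tau(i+1)}-\alpha_t\nabla_{\tau(i+1)}g_{\pi(j)}(x^{t,i,j},\xi^{t,i,j}),\qquad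 x^{t,i,j+1}_k=x^{t,i,j}_k\ \text{ for } k\ne\tau(i+1).$$ After the loop over $j$ set $x^{t,i+1,0}=x^{t,i,p}$; after the loop over $i$ set $x^{t+1,0,0}=x^{t,s,0}$ (equal to the last iterate obtained, also denoted $x^{t,s,p}$). Each $\xi^{t,i,j}$ is a fresh sample with the distribution of $\xi$, independent of all random information generated before it (the initial point, all earlier samples, and the current and earlier choices of $\tau$ and $\pi$). *)

(* Defs.v *)
From HB Require Import structures.
From mathcomp Require Export all_boot all_order all_algebra all_fingroup.
From mathcomp Require Export all_classical all_reals all_analysis.

Set Implicit Arguments.
Unset Strict Implicit.
Unset Printing Implicit Defensive.

Export Order.TTheory GRing.Theory Num.Theory.
Export numFieldNormedType.Exports.

Local Open Scope classical_set_scope.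
Local Open Scope ring_scope.

(* The library norm on ['rV_n] is the sup norm, hence this separate definition;
   both norms induce the same topology and the same differentiability. *)
Definition l2norm (R : realType) (n : nat) (v : 'rV[R]_n) : R :=
  Num.sqrt (\sum_c v 0 c ^+ 2).

Definition grad (R : realType) (n : nat) (h : 'rV[R]_n -> R) (x : 'rV[R]_n) :
    'rV[R]_n :=
  \row_c 'D_(delta_mx 0 c) h x.

Definition continuously_differentiable (R : realType) (n : nat)
    (h : 'rV[R]_n -> R) : Prop :=
  (forall x, differentiable h x) /\ continuous (grad h).

(* A partition of the coordinates into [s] blocks is given by the map [blk]
   sending a coordinate to its block.  The partial gradient with respect to
   block [b] is embedded in R^n by zeros outside [b], so that subtracting it
   leaves the other blocks unchanged. *)
Definition block_grad (R : realType) (n s : nat) (blk : 'I_n -> 'I_s)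
    (b : 'I_s) (h : 'rV[R]_n -> R) (x : 'rV[R]_n) : 'rV[R]_n :=
  \row_c (if blk c == b then grad h x 0 c else 0).

Definition weighted_sum (R : realType) (n q : nat) (m : 'I_q -> nat) (p : nat)
    (f : 'I_q -> 'rV[R]_n -> R) (x : 'rV[R]_n) : R :=
  \sum_k (m k)%:R / p%:R * f k x.

(* Coordinatewise expectation of a random vector. *)
Definition has_vector_expectation (d : measure_display) (Xi : measurableType d)
    (R : realType) (mu : probability Xi R) (n : nat) (h : Xi -> 'rV[R]_n)
    (v : 'rV[R]_n) : Prop :=
  forall c, mu.-integrable [set: Xi] (fun z => (h z 0 c)%:E) /\
    ('E_mu[fun z => (h z 0 c)%R])%E = (v 0 c)%:E.

(* Blocks and sample indices are numbered from 0: [tau t w i] is the block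
   treated in round [i] of outer iteration [t], and [pi t i w j] the objective
   sampled in its step [j].  The choices [tau] and [pi] are random: they may
   depend on the past of the run.  The iterates [x t i j] are constrained only
   for [t < T], [i <= s], [j <= p], together with the final [x T 0 0]. *)
Record block_smoo_run (d d' : measure_display) (Omega : measurableType d)
    (Xi : measurableType d') (R : realType) (n s q p : nat)
    (blk : 'I_n -> 'I_s) (m : 'I_q -> nat)
    (g : 'I_q -> 'rV[R]_n -> Xi -> R)
    (T : nat) (alpha : nat -> R) (x0 : 'rV[R]_n)
    (tau : nat -> Omega -> 'S_s)
    (pi : nat -> 'I_s -> Omega -> {ffun 'I_p -> 'I_q})
    (xi : nat -> 'I_s -> 'I_p -> Omega -> Xi)
    (x : nat -> nat -> nat -> Omega -> 'rV[R]_n) : Prop := {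
  run_freq : forall t (i : 'I_s) w k, (t < T)%N ->
    #|[set j | pi t i w j == k]%SET| = m k ;
  run_init : forall w, x 0%N 0%N 0%N w = x0 ;
  run_step : forall t (i : 'I_s) (j : 'I_p) w, (t < T)%N ->
    x t i j.+1 w = x t i j w -
      alpha t *: block_grad blk (tau t w i)
                   (fun y => g (pi t i w j) y (xi t i j w)) (x t i j w) ;
  run_next_block : forall t (i : 'I_s) w, (t < T)%N ->
    x t i.+1 0%N w = x t i p w ;
  run_next_iter : forall t w, (t < T)%N -> x t.+1 0%N 0%N w = x t s 0%N w
}.

(* Events generating the information available when the sample of index
   [(t, i, j)] is drawn: the earlier samples (in lexicographic order) and the
   current and earlier choices.  The initial point is deterministic. *)
Definition smoo_past (d d' : measure_display) (Omega : measurableType d)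
    (Xi : measurableType d') (s q p : nat)
    (tau : nat -> Omega -> 'S_s)
    (pi : nat -> 'I_s -> Omega -> {ffun 'I_p -> 'I_q})
    (xi : nat -> 'I_s -> 'I_p -> Omega -> Xi)
    (t : nat) (i : 'I_s) (j : 'I_p) : set (set Omega) :=
  [set A | exists (t' : nat) (i' : 'I_s) (j' : 'I_p) (B : set Xi),
     [/\ [\/ (t' < t)%N, t' = t /\ (i' < i)%N
           | [/\ t' = t, i' = i & (j' < j)%N]],
         measurable B & A = xi t' i' j' @^-1` B]] `|`
  [set A | exists (t' : nat) (u : 'S_s),
     (t' <= t)%N /\ A = [set w | tau t' w = u]] `|`
  [set A | exists (t' : nat) (i' : 'I_s) (v : {ffun 'I_p -> 'I_q}),
     ((t' < t)%N \/ t' = t /\ (i' <= i)%N) /\ A = [set w | pi t' i' w = v]].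

Definition independent_of (d d' : measure_display) (Omega : measurableType d)
    (Xi : measurableType d') (R : realType) (P : probability Omega R)
    (X : Omega -> Xi) (G : set (set Omega)) : Prop :=
  forall (A : set Omega) (B : set Xi), <<s G >> A -> measurable B ->
    (P (A `&` X @^-1` B) = P A * P (X @^-1` B))%E.

(* [mu] is the law of the random variable xi. *)
Record fresh_samples (d d' : measure_display) (Omega : measurableType d)
    (Xi : measurableType d') (R : realType) (P : probability Omega R)
    (mu : probability Xi R) (s q p T : nat)
    (tau : nat -> Omega -> 'S_s)
    (pi : nat -> 'I_s -> Omega -> {ffun 'I_p -> 'I_q})
    (xi : nat -> 'I_s -> 'I_p -> {RV P >-> Xi}) : Prop := {
  tau_measurable : forall t u, (t < T)%N -> measurable [set w | tau t w = u] ;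
  pi_measurable : forall t i v, (t < T)%N ->
    measurable [set w | pi t i w = v] ;
  sample_law : forall t i j (B : set Xi), (t < T)%N -> measurable B ->
    distribution P (xi t i j) B = mu B ;
  sample_indep : forall t i j, (t < T)%N ->
    independent_of P (xi t i j) (smoo_past tau pi xi t i j)
}.

(* Main.v *)
From HB Require Import structures.
Require Import Defs.
From mathcomp Require Import measurable_realfun ring lra.

(* Number all the elementary steps of the run consecutively, N = sp of them per
   outer iteration, and let G_l be the stochastic partial gradient of step l,
   D_l(y) the corresponding exact one at y.  With V_t = x^{t,0,0} - x*,
     |V_{t+1}|^2 = |V_t|^2 - 2 alpha <V_t, sum_l G_l> + alpha^2 |sum_l G_l|^2.
   The iterate at step l is a function of the past, from which the sample of
   step l is independent, so Fubini's theorem gives E<V_t, G_l - D_l(x_l)> = 0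
   and E|G_l|^2 <= sigma^2.  The error D_l(x_l) - D_l(x^{t,0,0}) is at most L
   times the drift alpha * sum_{k<l} |G_k|, whose mean is at most
   alpha * l * sigma.  Since every block is visited once and every f_k is
   sampled m_k times in each block, sum_l D_l(x^{t,0,0}) = p grad F_m, and
   convexity bounds <V_t, p grad F_m> below by p (F_m(x^{t,0,0}) - min F_m).
   Telescoping over t and Jensen's inequality conclude. *)

Set Implicit Arguments.
Unset Strict Implicit.
Unset Printing Implicit Defensive.

Local Open Scope classical_set_scope.
Local Open Scope ring_scope.

(** * Measurability *)

(** A preimage splits along the countably many values of [kap]; on each piece the composite is a
    single measurable [h k]. *)
Lemma measurable_countable_select d (D : measurableType d) d2
    (S : measurableType d2) (K : countType) (kap : D -> K) (h : K -> D -> S) :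
  (forall k, measurable (kap @^-1` [set k])) ->
  (forall k, measurable_fun setT (h k)) ->
  measurable_fun setT (fun w => h (kap w) w).
Proof.
move=> mkap mh _ B mB; rewrite setTI.
have -> : (fun w => h (kap w) w) @^-1` B =
    \bigcup_(n : nat) if unpickle n is Some k
      then kap @^-1` [set k] `&` h k @^-1` B else set0.
  apply/seteqP; split => w /=.
    by move=> Bw; exists (pickle (kap w)) => //; rewrite pickleK.
  by case=> n _; case: unpickle => //= k [-> ].
apply: bigcupT_measurable => n; case: unpickle => // k.
apply: measurableI; first exact: mkap.
by rewrite -[X in measurable X]setTI; exact: mh.
Qed.

Lemma cvg_rowP (R : realType) n (u : nat -> 'rV[R]_n) (v : 'rV[R]_n) :
  (forall c, u N 0 c @[N --> \oo] --> v 0 c) -> u N @[N --> \oo] --> v.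
Proof.
move=> uv A [/= Q vQ QA].
have : \forall N \near \oo, forall c, Q 0 c (u N 0 c).
  by apply: filter_forall => c; apply: uv; exact: vQ.
apply: filterS => N QN; apply: QA => i c; rewrite (ord1 i); exact: QN.
Qed.

(** Rounding down to the grid of mesh [1 / (N + 1)] moves [r] by at most one mesh. *)
Lemma cvg_floor_grid (R : realType) (r : R) :
  (Num.floor (N.+1%:R * r))%:~R / N.+1%:R @[N --> \oo] --> r.
Proof.
apply/cvgrPdist_le => e e0.
near=> N.
have N0 : 0 < N.+1%:R :> R by rewrite ltr0n.
have /andP[h1 h2] := floor_itv (N.+1%:R * r).
have -> : r - (Num.floor (N.+1%:R * r))%:~R / N.+1%:R =
   (N.+1%:R * r - (Num.floor (N.+1%:R * r))%:~R) / N.+1%:R.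
  by rewrite mulrBl [_ * r]mulrC mulfK ?gt_eqF.
rewrite ger0_norm; last by rewrite divr_ge0 ?subr_ge0// ltW.
rewrite (@le_trans _ _ (N.+1%:R^-1))//.
  rewrite ler_pdivrMr// mulVf ?gt_eqF// lerBlDr ltW//.
  by move: h2; rewrite intrD1 addrC.
near: N; have := @cvg_harmonic R => /cvgrPdist_le /(_ _ e0).
by apply: filterS => N; rewrite sub0r normrN ger0_norm// harmonic_ge0.
Unshelve. all: by end_near. Qed.

(* Approximating [u] by its values on finer and finer grids makes the composite
   a pointwise limit of countable gluings of the functions [g y]. *)
Lemma measurable_caratheodory (R : realType) d (D : measurableType d) d'
    (Xi : measurableType d') n (u : D -> 'rV[R]_n) (g : 'rV[R]_n -> Xi -> R) :
  (forall c, measurable_fun setT (fun w => u w 0 c)) ->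
  (forall y, measurable_fun setT (g y)) ->
  (forall z, continuous (g ^~ z)) ->
  measurable_fun setT (fun wz : D * Xi => g (u wz.1) wz.2).
Proof.
move=> mu mg cg.
pose k N w : 'rV[int]_n := \row_c Num.floor (N.+1%:R * u w 0 c).
pose v N (j : 'rV[int]_n) : 'rV[R]_n := \row_c ((j 0 c)%:~R / N.+1%:R).
apply: (measurable_fun_cvg (h := fun N (wz : D * Xi) => g (v N (k N wz.1)) wz.2)).
  move=> N.
  apply: (@measurable_countable_select _ _ _ _ _ (fun wz : D * Xi => k N wz.1)
    (fun j wz => g (v N j) wz.2)); last first.
    by move=> j; exact: measurableT_comp.
  move=> j; rewrite (_ : _ @^-1` _ = fst @^-1` (k N @^-1` [set j])) //.
  rewrite -[X in measurable X]setTI; apply: measurable_fst => //.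
  (* The points rounded to [j] form a box: coordinate [c], scaled by [N + 1], lies in a half-open
     unit interval starting at [j 0 c]. *)
  rewrite (_ : _ @^-1` _ = \bigcap_(c in [set: 'I_n])
     ((fun w => N.+1%:R * u w 0 c) @^-1` `[(j 0 c)%:~R, (j 0 c + 1)%:~R[ )).
    rewrite -[X in measurable X]setCK setC_bigcap; apply: measurableC.
    apply: fin_bigcup_measurable => [|c _]; first exact: finite_finset.
    apply: measurableC; rewrite -[X in measurable X]setTI.
    by apply: measurable_funM.
  apply/seteqP; split => w /=.
    by move=> <- c _ /=; rewrite in_itv/= mxE; exact: floor_itv.
  move=> jw; apply/rowP => c; rewrite mxE; apply/eqP.
  by have := jw c I; rewrite /= in_itv/= => /floor_def ->.
move=> [w z] _ /=; apply: (@cvg_comp _ _ _ (fun N => v N (k N w)) (g ^~ z)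
   _ (nbhs (u w))); last exact: cg.
by apply: cvg_rowP => c; under eq_fun do rewrite !mxE; exact: cvg_floor_grid.
Qed.

(** The limit defining the derivative, restricted to the steps [1 / (N + 1)]. A sequence serves both
    measurability of partial derivatives and, as these steps lie in []0, 1]], the convexity
    inequality. *)
Lemma cvg_harmonic_derive (R : realType) n (h : 'rV[R]_n -> R)
    (y v : 'rV[R]_n) :
  derivable h y v ->
  (harmonic N)^-1 * (h (harmonic N *: v + y) - h y) @[N --> \oo] --> 'D_v h y.
Proof.
move=> qD A /qD /= [e e0 eA].
have /cvgrPdist_lt /(_ _ e0) h0 := @cvg_harmonic R.
apply: filterS h0 => N; rewrite sub0r normrN => hN.
have hN0 : @harmonic R N != 0 by rewrite invr_neq0.
move: (eA (harmonic N)); rewrite /ball_ /= sub0r normrN => H.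
exact: (H hN hN0).
Qed.

(** A partial derivative is a pointwise limit of difference quotients, each jointly measurable by
    [measurable_caratheodory]. *)
Lemma measurable_partial (R : realType) d (D : measurableType d) d'
    (Xi : measurableType d') n (u : D -> 'rV[R]_n) (g : 'rV[R]_n -> Xi -> R)
    (c : 'I_n) :
  (forall c, measurable_fun setT (fun w => u w 0 c)) ->
  (forall y, measurable_fun setT (g y)) ->
  (forall z y, differentiable (g ^~ z) y) ->
  measurable_fun setT (fun wz : D * Xi => grad (g ^~ wz.2) (u wz.1) 0 c).
Proof.
move=> mu mg dg.
have cg z : continuous (g ^~ z).
  by move=> y; apply: differentiable_continuous; exact: dg.
apply: (measurable_fun_cvg (h := fun N (wz : D * Xi) => (harmonic N)^-1 *
  (g (harmonic N *: delta_mx 0 c + u wz.1) wz.2 - g (u wz.1) wz.2))).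
  move=> N; apply: measurable_funM => //; apply: measurable_funB.
    apply: (measurable_caratheodory
      (u := fun w => harmonic N *: delta_mx 0 c + u w)) => //.
    by move=> c'; under eq_fun do rewrite mxE; exact: measurable_funD.
  exact: (measurable_caratheodory mu mg cg).
move=> [w z] _ /=; rewrite mxE; apply: cvg_harmonic_derive.
exact: diff_derivable.
Qed.

(** * Integration against a fresh sample *)

(** One identity carries two facts: [A] full says that [X] has law [mu], and general [A] gives
    independence. With [Z] the identity into a coarser sigma-algebra, it is independence of that
    sigma-algebra. *)
Definition independent_with_law d d1 d2 (Omega : measurableType d)
    (D : measurableType d1) (Xi : measurableType d2) (R : realType)
    (P : probability Omega R) (mu : probability Xi R)
    (Z : Omega -> D) (X : Omega -> Xi) : Prop :=
  forall A B, measurable A -> measurable B ->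
    (P (Z @^-1` A `&` X @^-1` B) = P (Z @^-1` A) * mu B)%E.

(** Both measures agree on rectangles, which determines the product measure. *)
Lemma joint_law_product d d1 d2 (Omega : measurableType d)
    (D : measurableType d1) (Xi : measurableType d2) (R : realType)
    (P : probability Omega R) (mu : probability Xi R)
    (Z : {mfun Omega >-> D}) (ZX : {mfun Omega >-> (D * Xi)%type}) :
  (forall w, (ZX w).1 = Z w) ->
  independent_with_law P mu Z (snd \o ZX) ->
  forall A, measurable A ->
    (distribution P Z \x mu)%E A = distribution P ZX A.
Proof.
move=> ZXE indep A mA.
apply: product_measure_unique => // {mA}A B mA mB.
rewrite -[RHS](indep A B mA mB).
congr (P _); apply/seteqP; split => w /=; rewrite -ZXE.
  by move=> [].
by case: (ZX w).
Qed.

(** Replaces conditioning on the past: the joint law is a product, so Tonelli integrates the sample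
    first with [Z] frozen. *)
Lemma ge0_integral_freezing d d1 d2 (Omega : measurableType d)
    (D : measurableType d1) (Xi : measurableType d2) (R : realType)
    (P : probability Omega R) (mu : probability Xi R)
    (Z : Omega -> D) (X : Omega -> Xi) (h : D * Xi -> \bar R) :
  measurable_fun setT Z -> measurable_fun setT X ->
  independent_with_law P mu Z X ->
  measurable_fun setT h -> (forall v, 0 <= h v)%E ->
  (\int[P]_w h (Z w, X w) = \int[P]_w \int[mu]_z h (Z w, z))%E.
Proof.
move=> mZ mX indep mh h0.
pose Zm : {mfun Omega >-> D} := HB.pack Z (isMeasurableFun.Build _ _ _ _ _ mZ).
pose ZXm : {mfun Omega >-> (D * Xi)%type} := HB.pack (fun w => (Z w, X w))
  (isMeasurableFun.Build _ _ _ _ _ (measurable_fun_pair mZ mX)).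
rewrite -(ge0_integral_distribution ZXm mh h0).
rewrite -(eq_measure_integral (distribution P ZXm)
  (m1 := (distribution P Zm \x mu)%E)); last first.
  by move=> A mA _; exact: joint_law_product.
rewrite fubini_tonelli1// ge0_integral_distribution//.
  exact: measurable_fun_fubini_tonelli_F.
by move=> y; apply: integral_ge0.
Qed.

(** Signed counterpart, by Fubini; integrability of the composite under [P] is integrability of [h]
    under the product law. *)
Lemma integral_freezing d d1 d2 (Omega : measurableType d)
    (D : measurableType d1) (Xi : measurableType d2) (R : realType)
    (P : probability Omega R) (mu : probability Xi R)
    (Z : Omega -> D) (X : Omega -> Xi) (h : D * Xi -> \bar R) :
  measurable_fun setT Z -> measurable_fun setT X ->
  independent_with_law P mu Z X ->
  measurable_fun setT h ->
  P.-integrable setT (fun w => h (Z w, X w)) ->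
  P.-integrable setT (fun w => \int[mu]_z h (Z w, z))%E /\
  (\int[P]_w h (Z w, X w) = \int[P]_w \int[mu]_z h (Z w, z))%E.
Proof.
move=> mZ mX indep mh ih.
pose Zm : {mfun Omega >-> D} := HB.pack Z (isMeasurableFun.Build _ _ _ _ _ mZ).
pose ZXm : {mfun Omega >-> (D * Xi)%type} := HB.pack (fun w => (Z w, X w))
  (isMeasurableFun.Build _ _ _ _ _ (measurable_fun_pair mZ mX)).
have E A : measurable A -> (distribution P Zm \x mu)%E A = distribution P ZXm A.
  exact: joint_law_product.
have iprod : (distribution P Zm \x mu)%E.-integrable setT h.
  apply/integrableP; split => //.
  rewrite (eq_measure_integral (distribution P ZXm)); last by move=> A mA _; exact: E.
  rewrite ge0_integral_distribution//; last exact: measurableT_comp.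
  by have /integrableP[] := ih.
have iF := integrable_fubini_F iprod.
have mF : measurable_fun setT (fubini_F mu h) by exact: measurable_int iF.
have iF' : P.-integrable setT (fubini_F mu h \o Z).
  apply/integrableP; split; first exact: measurableT_comp.
  have /integrableP[_] := iF.
  by rewrite ge0_integral_distribution//; exact: measurableT_comp.
split; first exact: iF'.
rewrite -(integral_distribution (X := ZXm) mh ih).
rewrite -(eq_measure_integral (distribution P ZXm)
  (m1 := (distribution P Zm \x mu)%E)); last by move=> A mA _; exact: E.
by rewrite -integral12_prod_meas1// integral_distribution.
Qed.

(** * Euclidean geometry and one round of descent *)

Definition dotv (R : realType) n (u v : 'rV[R]_n) : R := \sum_c u 0 c * v 0 c.

Lemma dotvC (R : realType) n (u v : 'rV[R]_n) : dotv u v = dotv v u.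
Proof. by apply: eq_bigr => c _; rewrite mulrC. Qed.

Lemma dotvDr (R : realType) n (u v w : 'rV[R]_n) :
  dotv u (v + w) = dotv u v + dotv u w.
Proof. by rewrite -big_split; apply: eq_bigr => c _; rewrite mxE mulrDr. Qed.

Lemma dotvZr (R : realType) n a (u v : 'rV[R]_n) :
  dotv u (a *: v) = a * dotv u v.
Proof. by rewrite mulr_sumr; apply: eq_bigr => c _; rewrite mxE mulrCA. Qed.

Lemma dotvNr (R : realType) n (u v : 'rV[R]_n) : dotv u (- v) = - dotv u v.
Proof. by rewrite -scaleN1r dotvZr mulN1r. Qed.

Lemma dotvBr (R : realType) n (u v w : 'rV[R]_n) :
  dotv u (v - w) = dotv u v - dotv u w.
Proof. by rewrite dotvDr dotvNr. Qed.

Lemma dotv0r (R : realType) n (u : 'rV[R]_n) : dotv u 0 = 0.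
Proof. by rewrite -(scale0r 0) dotvZr mul0r. Qed.

Lemma dotv_sumr (R : realType) n (u : 'rV[R]_n) I (r : seq I) (P : pred I)
    (v : I -> 'rV[R]_n) :
  dotv u (\sum_(i <- r | P i) v i) = \sum_(i <- r | P i) dotv u (v i).
Proof. by apply: (big_morph (dotv u)); [exact: dotvDr|exact: dotv0r]. Qed.

Lemma l2norm_ge0 (R : realType) n (v : 'rV[R]_n) : 0 <= l2norm v.
Proof. exact: sqrtr_ge0. Qed.

Lemma l2norm_sqr (R : realType) n (v : 'rV[R]_n) :
  l2norm v ^+ 2 = \sum_c v 0 c ^+ 2.
Proof. by rewrite sqr_sqrtr// sumr_ge0// => c _; rewrite sqr_ge0. Qed.

Lemma dotvv (R : realType) n (v : 'rV[R]_n) : dotv v v = l2norm v ^+ 2.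
Proof. by rewrite l2norm_sqr; apply: eq_bigr => c _; rewrite expr2. Qed.

Lemma l2normB_sqr (R : realType) n (u v : 'rV[R]_n) :
  l2norm (u - v) ^+ 2 = l2norm u ^+ 2 - 2 * dotv u v + l2norm v ^+ 2.
Proof.
rewrite -!dotvv dotvBr dotvC dotvBr [dotv (u - v) v]dotvC dotvBr (dotvC v u).
ring.
Qed.

Lemma l2normZ (R : realType) n a (v : 'rV[R]_n) :
  l2norm (a *: v) = `|a| * l2norm v.
Proof.
rewrite /l2norm -sqrtr_sqr -sqrtrM ?sqr_ge0//; congr Num.sqrt.
by rewrite mulr_sumr; apply: eq_bigr => c _; rewrite mxE exprMn.
Qed.

Lemma l2norm0 (R : realType) n : l2norm (0 : 'rV[R]_n) = 0.
Proof. by rewrite -(scale0r 0) l2normZ normr0 mul0r. Qed.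

Lemma l2normN (R : realType) n (v : 'rV[R]_n) : l2norm (- v) = l2norm v.
Proof. by rewrite -scaleN1r l2normZ normrN1 mul1r. Qed.

Lemma l2norm_eq0 (R : realType) n (v : 'rV[R]_n) : l2norm v = 0 -> v = 0.
Proof.
move=> v0; have := l2norm_sqr v; rewrite v0 expr0n/= => /esym/eqP.
rewrite psumr_eq0; last by move=> c _; exact: sqr_ge0.
move=> /allP vc; apply/rowP => c; rewrite mxE; apply/eqP.
by rewrite -sqrf_eq0; apply: vc; rewrite mem_index_enum.
Qed.

(** Cauchy-Schwarz: expand the squared norm of [l2norm v *: u - l2norm u *: v] and divide by the
    product of the norms, zero vectors being treated apart. *)
Lemma dotv_le (R : realType) n (u v : 'rV[R]_n) :
  dotv u v <= l2norm u * l2norm v.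
Proof.
have [/l2norm_eq0->|u0] := eqVneq (l2norm u) 0.
  by rewrite dotvC dotv0r mulr_ge0// l2norm_ge0.
have [/l2norm_eq0->|v0] := eqVneq (l2norm v) 0.
  by rewrite dotv0r mulr_ge0// l2norm_ge0.
have uv : 0 < l2norm u * l2norm v by rewrite mulr_gt0// lt0r ?u0 ?v0 l2norm_ge0.
have := sqr_ge0 (l2norm (l2norm v *: u - l2norm u *: v)).
rewrite l2normB_sqr !l2normZ !ger0_norm ?l2norm_ge0// dotvZr dotvC dotvZr dotvC.
by move=> H; rewrite -(ler_pM2l uv); nra.
Qed.

Lemma normr_dotv_le (R : realType) n (u v : 'rV[R]_n) :
  `|dotv u v| <= l2norm u * l2norm v.
Proof.
rewrite ler_norml dotv_le andbT lerNl.
by rewrite -dotvNr -(l2normN v) dotv_le.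
Qed.

Lemma l2normD (R : realType) n (u v : 'rV[R]_n) :
  l2norm (u + v) <= l2norm u + l2norm v.
Proof.
rewrite -(@ler_pXn2r _ 2)// ?nnegrE ?addr_ge0 ?l2norm_ge0//.
rewrite -{1}(opprK v) l2normB_sqr l2normN dotvNr.
by have := dotv_le u v; nra.
Qed.

Lemma l2norm_sum (R : realType) n N (v : nat -> 'rV[R]_n) :
  l2norm (\sum_(l < N) v l) <= \sum_(l < N) l2norm (v l).
Proof.
elim: N => [|N IH].
  by rewrite !big_ord0 l2norm0.
by rewrite !big_ord_recr/= (le_trans (l2normD _ _))// lerD2r.
Qed.

(** By induction, the new cross term being split between the old squares and the new one. The empty
    sum is separate because the weight [N] must be positive. *)
Lemma l2norm_sum_sqr (R : realType) n N (v : nat -> 'rV[R]_n) :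
  l2norm (\sum_(l < N) v l) ^+ 2 <= N%:R * \sum_(l < N) l2norm (v l) ^+ 2.
Proof.
elim: N => [|N IH].
  by rewrite !big_ord0 l2norm0 expr0n/= mul0r.
rewrite !big_ord_recr/=.
set S := \sum_(_ < N) v _ in IH *; set Q := \sum_(_ < N) _ in IH *.
have Q0 : 0 <= Q by apply: sumr_ge0 => l _; rewrite sqr_ge0.
rewrite -{1}(opprK (v N)) l2normB_sqr l2normN dotvNr.
have [N0|N0] := posnP N.
  have -> : S = 0 by rewrite /S; move: N0 => ->; rewrite big_ord0.
  rewrite dotvC dotv0r l2norm0 expr0n/= oppr0 mulr0 subr0 add0r.
  by have -> : N.+1%:R = 1 :> R by [rewrite N0]; rewrite mul1r lerDr.
(* Young's inequality with weight N *)
have Young : 2 * dotv S (v N) <= Q + N%:R * l2norm (v N) ^+ 2.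
  have Np : 0 < N%:R :> R by rewrite ltr0n.
  have := sqr_ge0 (l2norm (S - N%:R *: v N)).
  rewrite l2normB_sqr dotvZr l2normZ ger0_norm ?ler0n// exprMn => H.
  by rewrite -(ler_pM2l Np); nra.
rewrite mulrSr; nra.
Qed.

(** * Gradients and the first-order convexity inequality *)

Lemma grad_dotv (R : realType) n (h : 'rV[R]_n -> R) (y v : 'rV[R]_n) :
  differentiable h y -> 'D_v h y = dotv (grad h y) v.
Proof.
move=> dh; rewrite deriveE// {1}(row_sum_delta v) linear_sum.
by apply: eq_bigr => c _; rewrite linearZ/= mxE deriveE// mulrC.
Qed.

(** By convexity every difference quotient from [y] towards [z] with step in []0, 1]] is at most
    [h z - h y]; the limit inherits the bound. *)
Lemma convex_grad_le (R : realType) n (h : 'rV[R]_n -> R) (y z : 'rV[R]_n) :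
  convex_function [set: 'rV[R]_n] h -> differentiable h y ->
  dotv (grad h y) (z - y) <= h z - h y.
Proof.
move=> ch dh; rewrite -grad_dotv//.
have qD := cvg_harmonic_derive (@diff_derivable R _ _ _ _ (z - y) dh).
rewrite -(cvg_lim _ qD)//; apply: limr_le; first by apply/cvg_ex; eexists; exact: qD.
apply: nearW => N.
have hN0 : 0 < @harmonic R N by exact: harmonic_gt0.
have hN1 : @harmonic R N <= 1 by rewrite invf_le1 ?ler1n ?ltr0n.
rewrite ler_pdivrMl//.
have := ch (Itv01 (ltW hN0) hN1) z y; rewrite !inE => /(_ I I).
rewrite convRE /= => {}ch.
have E : harmonic N *: (z - y) + y = harmonic N *: z + (1 - harmonic N) *: y.
  by rewrite scalerBr scalerBl scale1r addrAC addrA.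
rewrite E; move: ch; rewrite /conv/= /unstable.onem => H.
apply: le_trans (lerB H (lexx _)) _.
rewrite le_eqVlt; apply/orP; left; apply/eqP; ring.
Qed.

(** * Projections onto blocks of coordinates *)

Section block_projection.
Variables (R : realType) (n s : nat) (blk : 'I_n -> 'I_s).

(** [block_grad] is this projection applied to a gradient; isolating it gives access to linearity
    and nonexpansiveness. *)
Definition block_proj (b : 'I_s) (v : 'rV[R]_n) : 'rV[R]_n :=
  \row_c (if blk c == b then v 0 c else 0).

Lemma block_projB b (u v : 'rV[R]_n) :
  block_proj b u - block_proj b v = block_proj b (u - v).
Proof. by apply/rowP => c; rewrite !mxE; case: ifP; rewrite ?subrr. Qed.

Lemma l2norm_block_proj b (v : 'rV[R]_n) : l2norm (block_proj b v) <= l2norm v.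
Proof.
rewrite ler_wsqrtr//; apply: ler_sum => c _; rewrite mxE; case: ifP => // _.
by rewrite expr0n/= sqr_ge0.
Qed.

(** Coordinate [c] survives in exactly one term, the one whose index [tau] sends to [blk c]. *)
Lemma sum_block_proj (tau : 'S_s) (v : 'rV[R]_n) :
  \sum_i block_proj (tau i) v = v.
Proof.
apply/rowP => c; rewrite summxE (bigD1 (tau^-1%g (blk c)))//= mxE permKV eqxx.
rewrite big1 ?addr0// => i ic; rewrite mxE ifN//.
by apply: contra ic => /eqP->; rewrite permK.
Qed.

End block_projection.

(** * Pathwise descent inequality over one round of [N] steps *)

Section descent.
Variables (R : realType) (n N : nat) (a : R) (X G : nat -> 'rV[R]_n).
Hypothesis a_ge0 : 0 <= a.
Hypothesis stepX : forall l, (l < N)%N -> X l.+1 = X l - a *: G l.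

Lemma iterate_telescope k : (k <= N)%N ->
  X k = X 0%N - a *: \sum_(l < k) G l.
Proof.
elim: k => [|k IH] kN; first by rewrite big_ord0 scaler0 subr0.
by rewrite stepX// IH 1?ltnW// big_ord_recr/= scalerDr opprD addrA.
Qed.

Lemma iterate_drift k : (k <= N)%N ->
  l2norm (X k - X 0%N) <= a * \sum_(l < k) l2norm (G l).
Proof.
move=> kN; rewrite iterate_telescope// addrAC subrr add0r l2normN l2normZ.
by rewrite ger0_norm// ler_wpM2l// l2norm_sum.
Qed.

(* [D l] is the exact gradient whose stochastic estimate at [X l] is [G l]. *)
Lemma descent_step (D : nat -> 'rV[R]_n -> 'rV[R]_n) (z : 'rV[R]_n)
    (L Delta gap : R) :
  0 <= L -> l2norm (X 0%N - z) <= Delta ->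
  (forall l y y', l2norm (D l y - D l y') <= L * l2norm (y - y')) ->
  gap <= dotv (X 0%N - z) (\sum_(l < N) D l (X 0%N)) ->
  2 * a * gap + l2norm (X N - z) ^+ 2 <= l2norm (X 0%N - z) ^+ 2
    + \sum_(l < N) (- (2 * a) * dotv (X 0%N - z) (G l - D l (X l))
        + 2 * a ^+ 2 * L * Delta * \sum_(k < l) l2norm (G k)
        + a ^+ 2 * N%:R * l2norm (G l) ^+ 2).
Proof.
move=> L0 VD DL Hgap; set V := X 0%N - z in VD Hgap *.
have -> : X N - z = V - a *: \sum_(l < N) G l.
  by rewrite iterate_telescope// /V addrAC.
rewrite l2normB_sqr dotvZr l2normZ ger0_norm// exprMn.
have Gsq := l2norm_sum_sqr N G.
(* Moving the exact gradient from [X l] back to the start of the round costs at most [Delta * L]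
   times the drift, by Cauchy-Schwarz and the Lipschitz bound. *)
have err (l : 'I_N) : dotv V (D l (X 0%N)) <= dotv V (G l)
   - dotv V (G l - D l (X l)) + a * L * Delta * \sum_(k < l) l2norm (G k).
  have -> : dotv V (G l) - dotv V (G l - D l (X l)) = dotv V (D l (X l)).
    by rewrite -dotvBr opprB addrC subrK.
  rewrite addrC -lerBlDr -dotvBr (le_trans (dotv_le _ _))//.
  rewrite (le_trans (ler_pM (l2norm_ge0 _) (l2norm_ge0 _) VD (DL _ _ _)))//.
  have Del0 : 0 <= Delta := le_trans (l2norm_ge0 _) VD.
  rewrite [leLHS](_ : _ = L * Delta * l2norm (X l - X 0%N)); last first.
    by rewrite -l2normN opprB; ring.
  rewrite [leRHS](_ : _ = L * Delta * (a * \sum_(k < l) l2norm (G k))); last by ring.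
  by rewrite ler_wpM2l ?mulr_ge0// iterate_drift// ltnW.
have serr : \sum_(l < N) dotv V (D l (X 0%N)) <= _ := ler_sum _ (fun l _ => err l).
rewrite -dotv_sumr in serr.
move: (le_trans Hgap serr); rewrite 2!big_split/= sumrN -dotv_sumr.
rewrite 2!big_split/= -!mulr_sumr.
set S1 := dotv V _; set S2 := \sum_(_ < N) dotv V _.
set S3 := \sum_(_ < N) _; set S4 := \sum_(_ < N) _ in Gsq *.
move=> Hg.
have := ler_wpM2l (sqr_ge0 a) Gsq; have := ler_wpM2l a_ge0 Hg.
nra.
Qed.

End descent.

(** * Bounds on means *)

Section mean_le.
Context d (Omega : measurableType d) (R : realType) (P : probability Omega R).
Implicit Types (h k : Omega -> R) (a b : R).

(** Integrability is bundled with the bound so that bounds add and scale without side conditions. *)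
Definition mean_le h b : Prop :=
  P.-integrable setT (EFin \o h) /\ (\int[P]_w (h w)%:E <= b%:E)%E.

Lemma mean_leW h a b : a <= b -> mean_le h a -> mean_le h b.
Proof. by move=> ab [ih ha]; split=> //; rewrite (le_trans ha) ?lee_fin. Qed.

Lemma mean_le_cst b : mean_le (fun=> b) b.
Proof.
split; first exact: finite_measure_integrable_cst.
by rewrite integral_cst//= probability_setT mule1.
Qed.

Lemma mean_leD h k a b :
  mean_le h a -> mean_le k b -> mean_le (fun w => h w + k w) (a + b).
Proof.
move=> [ih ha] [ik kb]; split; first exact: (integrableD measurableT ih ik).
by under eq_integral do rewrite EFinD; rewrite integralD// EFinD leeD.
Qed.

Lemma mean_leZ h a b : 0 <= a -> mean_le h b -> mean_le (fun w => a * h w) (a * b).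
Proof.
move=> a0 [ih hb]; split; first exact: (integrableZl measurableT a ih).
by under eq_integral do rewrite EFinM; rewrite integralZl// EFinM lee_wpmul2l.
Qed.

Lemma mean_le_sum N (h : nat -> Omega -> R) (b : nat -> R) :
  (forall l, (l < N)%N -> mean_le (h l) (b l)) ->
  mean_le (fun w => \sum_(l < N) h l w) (\sum_(l < N) b l).
Proof.
elim: N => [|N IH] hb.
  by under [X in mean_le X]eq_fun do rewrite big_ord0; rewrite big_ord0; exact: mean_le_cst.
under [X in mean_le X]eq_fun do rewrite big_ord_recr.
rewrite big_ord_recr; apply: mean_leD; last exact: hb.
by apply: IH => l lN; apply: hb; exact: ltnW.
Qed.

(** Serves for the final estimate, where the pathwise bound holds only almost surely. *)
Lemma integral_le_mean h k b :
  measurable_fun setT h -> (forall w, 0 <= h w) ->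
  {ae P, forall w, h w <= k w} -> mean_le k b ->
  (\int[P]_w (h w)%:E <= b%:E)%E.
Proof.
move=> mh h0 hk [ik kb]; apply: le_trans kb.
have mk : measurable_fun setT (fun w => (k w)%:E) by exact: measurable_int ik.
(* On the exceptional null set [k] may be negative; its positive part has the same integral and
   allows monotonicity for nonnegative functions. *)
have mk' : measurable_fun setT (fun w => (Num.max (k w) 0)%:E).
  by apply/measurable_EFinP/measurable_maxr => //; exact/measurable_EFinP.
rewrite -(ae_eq_integral (fun w => (k w)%:E) (fun w => (Num.max (k w) 0)%:E))//.
  apply: ae_ge0_le_integral => //.
  - by move=> w _; rewrite lee_fin.
  - exact/measurable_EFinP.
  - by move=> w _; rewrite lee_fin le_max lexx orbT.
  - by apply: filterS hk => w hw _; rewrite lee_fin le_max hw.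
by apply: filterS hk => w hw _; rewrite max_l// (le_trans (h0 w)).
Qed.

(* AM-GM with weight [c > b] bounds the norm by its square; then c -> b. *)
Lemma mean_le_of_sqr h b : 0 <= b -> measurable_fun setT h -> (forall w, 0 <= h w) ->
  mean_le (fun w => h w ^+ 2) (b ^+ 2) -> mean_le h b.
Proof.
move=> b0 mh h0 h2.
have bound c : 0 < c -> mean_le (fun w => c / 2 + (2 * c)^-1 * h w ^+ 2)
   (c / 2 + (2 * c)^-1 * b ^+ 2).
  move=> c0; apply: mean_leD; first exact: mean_le_cst.
  by apply: mean_leZ => //; rewrite invr_ge0 mulr_ge0 ?ltW.
have amgm c w : 0 < c -> h w <= c / 2 + (2 * c)^-1 * h w ^+ 2.
  move=> c0; rewrite -(ler_pM2l (_ : 0 < 2 * c)) ?mulr_gt0//.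
  rewrite mulrDr mulVKf ?mulf_neq0 ?gt_eqF//.
  have -> : 2 * c * (c / 2) = c ^+ 2 by field.
  by have := sqr_ge0 (h w - c); nra.
split.
  have [i1 _] := bound _ (ltr01).
  apply: le_integrable i1 => //; first exact/measurable_EFinP.
  move=> w _; rewrite /= lee_fin ger0_norm// ger0_norm ?amgm//.
  by rewrite addr_ge0// mulr_ge0// ?sqr_ge0 ?invr_ge0.
apply/lee_addgt0Pr => e e0.
have c0 : 0 < b + e by rewrite ltr_wpDl.
rewrite -EFinD; apply: (@integral_le_mean _ (fun w => (b + e) / 2 + (2 * (b + e))^-1 * h w ^+ 2)) => //.
  by apply: aeW => w; exact: amgm.
apply: mean_leW (bound _ c0).
rewrite -(ler_pM2l (_ : 0 < 2 * (b + e))) ?mulr_gt0//.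
rewrite mulrDr mulVKf ?mulf_neq0 ?gt_eqF//.
have -> : 2 * (b + e) * ((b + e) / 2) = (b + e) ^+ 2 by field.
nra.
Qed.

End mean_le.

Lemma measurable_dotv (R : realType) d (D : measurableType d) n
    (u v : D -> 'rV[R]_n) :
  (forall c, measurable_fun setT (fun w => u w 0 c)) ->
  (forall c, measurable_fun setT (fun w => v w 0 c)) ->
  measurable_fun setT (fun w => dotv (u w) (v w)).
Proof. by move=> mu mv; apply: measurable_sum => c; exact: measurable_funM. Qed.

Lemma measurable_l2norm_sqr (R : realType) d (D : measurableType d) n
    (u : D -> 'rV[R]_n) :
  (forall c, measurable_fun setT (fun w => u w 0 c)) ->
  measurable_fun setT (fun w => l2norm (u w) ^+ 2).
Proof.
by move=> mu; under eq_fun do rewrite -dotvv; exact: measurable_dotv.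
Qed.

Lemma measurable_l2norm (R : realType) d (D : measurableType d) n
    (u : D -> 'rV[R]_n) :
  (forall c, measurable_fun setT (fun w => u w 0 c)) ->
  measurable_fun setT (fun w => l2norm (u w)).
Proof.
move=> mu.
have m2 : measurable_fun setT (fun w => \sum_c u w 0 c ^+ 2).
  by apply: measurable_sum => c; exact: measurable_funX.
have ms : measurable_fun setT (@Num.sqrt R).
  by apply: continuous_measurable_fun; exact: sqrt_continuous.
exact: (measurableT_comp ms m2).
Qed.

(** * Incremental stochastic gradient runs *)

Section incremental_run.
Context (R : realType) (d d' : measure_display).
Context (Omega : measurableType d) (P : probability Omega R).
Context (Xi : measurableType d') (mu : probability Xi R) (n s q : nat).
Variables (blk : 'I_n -> 'I_s).
Variables (f : 'I_q -> 'rV[R]_n -> R) (g : 'I_q -> 'rV[R]_n -> Xi -> R).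
Variables (a sigma : R) (x0 : 'rV[R]_n).
Variables (beta : nat -> Omega -> 'I_s) (kappa : nat -> Omega -> 'I_q).
Variables (zeta : nat -> Omega -> Xi) (X : nat -> Omega -> 'rV[R]_n) (M : nat).

Definition sampled_grad b k x z : 'rV[R]_n :=
  block_proj blk b (grad (g k ^~ z) x).

(** The point [y] is kept free: the same block and objective are evaluated both at [X l] and at the
    start of the round. *)
Definition true_grad l w y : 'rV[R]_n :=
  block_proj blk (beta l w) (grad (f (kappa l w)) y).

Definition sgd_step l w : 'rV[R]_n :=
  sampled_grad (beta l w) (kappa l w) (X l w) (zeta l w).

(* What is known before the sample of step [l] is drawn is [history l l.+1]: the
   choices of a step precede its sample, while [X l] only depends on
   [history l l]. *)
Definition history l l' : set (set Omega) :=
  [set A | exists k (B : set Xi),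
     [/\ (k < l)%N, measurable B & A = zeta k @^-1` B]] `|`
  [set A | exists k i, (k < l')%N /\ A = beta k @^-1` [set i]] `|`
  [set A | exists k i, (k < l')%N /\ A = kappa k @^-1` [set i]].

Hypothesis g_measurable : forall k y, measurable_fun setT (g k y).
Hypothesis g_differentiable : forall k z y, differentiable (g k ^~ z) y.
Hypothesis sigma_ge0 : 0 <= sigma.
Hypothesis g_unbiased : forall k y,
  has_vector_expectation mu (fun z => grad (g k ^~ z) y) (grad (f k) y).
Hypothesis g_bounded : forall k y,
  ('E_mu[fun z => (l2norm (grad (g k ^~ z) y) ^+ 2)%R] <= (sigma ^+ 2)%:E)%E.
Hypothesis X_init : forall w, X 0%N w = x0.
Hypothesis X_step : forall l w, (l < M)%N -> X l.+1 w = X l w - a *: sgd_step l w.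
Hypothesis beta_measurable : forall l i, (l < M)%N ->
  measurable (beta l @^-1` [set i]).
Hypothesis kappa_measurable : forall l k, (l < M)%N ->
  measurable (kappa l @^-1` [set k]).
Hypothesis zeta_measurable : forall l, (l < M)%N -> measurable_fun setT (zeta l).
Hypothesis zeta_indep : forall l, (l < M)%N ->
  independent_with_law P mu
    (id : Omega -> g_sigma_algebraType (history l l.+1)) (zeta l).

(** Block and objective take finitely many values, and for fixed values [measurable_partial]
    applies. *)
Lemma measurable_sampled_grad d1 (D : measurableType d1) (b : D -> 'I_s)
    (k : D -> 'I_q) (x : D -> 'rV[R]_n) :
  (forall i, measurable (b @^-1` [set i])) ->
  (forall i, measurable (k @^-1` [set i])) ->
  (forall c, measurable_fun setT (fun w => x w 0 c)) ->
  forall c, measurable_fun setT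
    (fun wz : D * Xi => sampled_grad (b wz.1) (k wz.1) (x wz.1) wz.2 0 c).
Proof.
move=> mb mk mx c.
have mfst (A : set D) : measurable A -> measurable (fst @^-1` A : set (D * Xi)).
  by move=> mA; rewrite -[X in measurable X]setTI; exact: measurable_fst.
apply: (measurable_countable_select (K := ('I_s * 'I_q)%type)
  (kap := fun wz : D * Xi => (b wz.1, k wz.1))
  (h := fun i wz => sampled_grad i.1 i.2 (x wz.1) wz.2 0 c)).
  move=> [i j]; rewrite (_ : _ @^-1` _ =
    fst @^-1` (b @^-1` [set i] `&` k @^-1` [set j])).
    by apply: mfst; exact: measurableI.
  by apply/seteqP; split => -[w z] /= [-> ->].
move=> [i j] /=; under eq_fun do rewrite mxE.
case: (blk c == i); last exact: measurable_cst.
by apply: measurable_partial => // z y; exact: g_differentiable.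
Qed.

(** Unrolling the recursion, [X l] uses only the data of steps before [l]. The map [r] lets the
    lemma serve both the full sigma-algebra of [Omega] and the coarser history. *)
Lemma measurable_iterate d1 (D : measurableType d1) (r : D -> Omega) l :
  (l <= M)%N ->
  (forall k, (k < l)%N -> measurable_fun setT (zeta k \o r)) ->
  (forall k i, (k < l)%N -> measurable ((beta k \o r) @^-1` [set i])) ->
  (forall k i, (k < l)%N -> measurable ((kappa k \o r) @^-1` [set i])) ->
  forall c, measurable_fun setT (fun w => X l (r w) 0 c).
Proof.
elim: l => [|l IH] lM mz mb mk c.
  by under eq_fun do rewrite X_init; exact: measurable_cst.
have mX c' : measurable_fun setT (fun w => X l (r w) 0 c').
  apply: IH; first exact: ltnW.
  - by move=> k kl; apply: mz; exact: ltnW.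
  - by move=> k i kl; apply: mb; exact: ltnW.
  - by move=> k i kl; apply: mk; exact: ltnW.
under eq_fun do rewrite X_step// mxE mxE mxE.
apply: measurable_funB => //; apply: measurable_funM => //.
have mG := measurable_sampled_grad (fun i => mb l i (ltnSn l))
  (fun i => mk l i (ltnSn l)) mX c.
have mrz : measurable_fun setT (fun w => (w, zeta l (r w))).
  by apply: measurable_fun_pair => //; exact: mz.
exact: (measurableT_comp mG mrz).
Qed.

Lemma measurable_X l c : (l <= M)%N -> measurable_fun setT (fun w => X l w 0 c).
Proof.
move=> lM; apply: (measurable_iterate (r := id)) => // k.
- by move=> kl; apply: zeta_measurable; exact: leq_trans lM.
- by move=> i kl; apply: beta_measurable; exact: leq_trans lM.
- by move=> i kl; apply: kappa_measurable; exact: leq_trans lM.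
Qed.

Lemma measurable_sgd_step l c : (l < M)%N ->
  measurable_fun setT (fun w => sgd_step l w 0 c).
Proof.
move=> lM.
have mG := measurable_sampled_grad (fun i => beta_measurable i lM)
  (fun i => kappa_measurable i lM) (fun c => measurable_X c (ltnW lM)) c.
have mz : measurable_fun setT (fun w => (w, zeta l w)).
  by apply: measurable_fun_pair => //; exact: zeta_measurable.
exact: (measurableT_comp mG mz).
Qed.

(** All generators of the history are events. Measurability of the identity is the form in which the
    freezing lemmas take this. *)
Lemma history_sub l l' : (l <= M)%N -> (l' <= M)%N ->
  measurable_fun setT (id : Omega -> g_sigma_algebraType (history l l')).
Proof.
move=> lM l'M _ A mA; rewrite setTI.
apply: (smallest_sub (@sigma_algebra_measurable _ Omega) _ mA).
move=> {A mA} A [[[k [B [kl mB ->]]]|[k [i [kl ->]]]]|[k [i [kl ->]]]].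
- rewrite -[X in measurable X]setTI; apply: zeta_measurable => //.
  exact: leq_trans lM.
- by apply: beta_measurable; exact: leq_trans l'M.
- by apply: kappa_measurable; exact: leq_trans l'M.
Qed.

Section history_measurability.
Variable l : nat.
Hypothesis lM : (l < M)%N.
Local Notation H := (g_sigma_algebraType (history l l.+1)).

Lemma history_choice_measurable k :
  (k <= l)%N -> (forall i, measurable (beta k @^-1` [set i] : set H)) /\
  (forall i, measurable (kappa k @^-1` [set i] : set H)).
Proof.
move=> kl; split => i; apply: sub_sigma_algebra.
- by left; right; exists k, i.
- by right; exists k, i.
Qed.

Lemma history_iterate_measurable k c : (k <= l)%N ->
  measurable_fun setT (fun w : H => X k w 0 c).
Proof.
move=> kl; apply: (measurable_iterate (r := id : H -> Omega)).
- exact: (leq_trans kl (ltnW lM)).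
- move=> i ik _ B mB; rewrite setTI; apply: sub_sigma_algebra.
  by left; left; exists i, B; split => //; exact: leq_trans kl.
- move=> i j ik; apply: (history_choice_measurable _).1.
  by rewrite ltnW// (leq_trans ik).
- move=> i j ik; apply: (history_choice_measurable _).2.
  by rewrite ltnW// (leq_trans ik).
Qed.

Lemma history_grad_measurable c : measurable_fun setT
  (fun wz : H * Xi =>
     sampled_grad (beta l wz.1) (kappa l wz.1) (X l wz.1) wz.2 0 c).
Proof.
have [mb mk] := history_choice_measurable (leqnn l).
apply: (@measurable_sampled_grad _ H (beta l) (kappa l) (X l)) => // c'.
exact: history_iterate_measurable.
Qed.

End history_measurability.

(** With the past frozen, the block and the iterate are constants, so [g_bounded] and
    nonexpansiveness of the projection bound the inner integral for every [w]. *)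
Lemma second_moment l : (l < M)%N ->
  mean_le P (fun w => l2norm (sgd_step l w) ^+ 2) (sigma ^+ 2).
Proof.
move=> lM.
pose h (wz : g_sigma_algebraType (history l l.+1) * Xi) : \bar R :=
  (l2norm (sampled_grad (beta l wz.1) (kappa l wz.1) (X l wz.1) wz.2) ^+ 2)%:E.
have mh : measurable_fun setT h.
  apply/measurable_EFinP; apply: measurable_l2norm_sqr => c.
  exact: history_grad_measurable.
have h0 v : (0 <= h v)%E by rewrite lee_fin sqr_ge0.
have mgrad k y : measurable_fun setT (fun z => l2norm (grad (g k ^~ z) y) ^+ 2).
  apply: measurable_l2norm_sqr => c; have [+ _] := g_unbiased k y c.
  by move/measurable_int/measurable_EFinP.
have inner w : (\int[mu]_z h (w, z) <= (sigma ^+ 2)%:E)%E.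
  have := g_bounded (kappa l w) (X l w); rewrite unlock; apply: le_trans.
  apply: ge0_le_integral => //.
  - exact: (measurable_fun_pair2 w mh).
  - exact/measurable_EFinP.
  - by move=> z _; rewrite lee_fin ler_sqr ?nnegrE ?l2norm_ge0// l2norm_block_proj.
have mid : measurable_fun setT (id : Omega -> g_sigma_algebraType (history l l.+1)).
  exact: history_sub (ltnW lM) lM.
have le2 : (\int[P]_w (l2norm (sgd_step l w) ^+ 2)%:E <= (sigma ^+ 2)%:E)%E.
  have := ge0_integral_freezing mid (zeta_measurable lM) (zeta_indep lM) mh h0.
  rewrite /h/= => ->.
  rewrite [leRHS](_ : _ = \int[P]_w (cst (sigma ^+ 2)%:E w))%E; last first.
    by rewrite integral_cst//= probability_setT mule1.
  apply: ge0_le_integral => //.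
  - by move=> w _; apply: integral_ge0 => v _; rewrite lee_fin sqr_ge0.
  - exact: (measurableT_comp (measurable_fun_fubini_tonelli_F _ mh h0) mid).
  - by move=> w _; exact: inner.
split => //; apply/integrableP; split.
  apply/measurable_EFinP; apply: measurable_l2norm_sqr => c.
  exact: measurable_sgd_step.
under eq_integral do rewrite /= ger0_norm ?sqr_ge0//.
by rewrite (le_lt_trans le2)// ltry.
Qed.

(** One step preserves square integrability, as the squared norm of [u - a *: v] is at most twice
    that of [u] plus twice that of [a *: v]. *)
Lemma iterate_square_integrable l (z : 'rV[R]_n) : (l <= M)%N ->
  P.-integrable setT (fun w => (l2norm (X l w - z) ^+ 2)%:E).
Proof.
elim: l => [|l IH] lM.
  under eq_fun do rewrite X_init; exact: finite_measure_integrable_cst.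
have [iG _] := second_moment lM.
have iX := IH (ltnW lM).
have m2 : measurable_fun setT (fun w => (l2norm (X l.+1 w - z) ^+ 2)%:E).
  apply/measurable_EFinP; apply: measurable_l2norm_sqr => c.
  under eq_fun do rewrite mxE; apply: measurable_funD => //; exact: measurable_X.
apply: (le_integrable measurableT m2 _ (integrableD measurableT
  (integrableZl measurableT 2 iX) (integrableZl measurableT (2 * a ^+ 2) iG))).
move=> w _ /=; rewrite lee_fin [leLHS]ger0_norm ?sqr_ge0//.
rewrite [leRHS]ger0_norm; last first.
  by rewrite addr_ge0// mulr_ge0 ?sqr_ge0// mulr_ge0 ?sqr_ge0.
have -> : X l.+1 w - z = (X l w - z) - a *: sgd_step l w.
  by rewrite X_step// addrAC.
move: (X l w - z) (sgd_step l w) => u v.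
(* Nonnegativity of the squared norm of [u + a *: v] bounds the cross term, as in the parallelogram
   law. *)
have := sqr_ge0 (l2norm (u - (- a) *: v)).
rewrite !l2normB_sqr !dotvZr !l2normZ !exprMn normrN real_normK ?num_real//.
by nra.
Qed.

(** The product of two norms is at most the sum of their squares, both integrable. *)
Lemma dotv_step_integrable k l (z : 'rV[R]_n) : (k <= M)%N -> (l < M)%N ->
  P.-integrable setT (fun w => (dotv (X k w - z) (sgd_step l w))%:E).
Proof.
move=> kM lM.
have [iG _] := second_moment lM.
have m2 : measurable_fun setT (fun w => (dotv (X k w - z) (sgd_step l w))%:E).
  apply/measurable_EFinP; apply: measurable_dotv => c.
    under eq_fun do rewrite mxE.
    by apply: measurable_funD => //; exact: measurable_X.
  exact: measurable_sgd_step.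
apply: (le_integrable measurableT m2 _
  (integrableD measurableT (iterate_square_integrable z kM) iG)).
move=> w _ /=; rewrite lee_fin [leRHS]ger0_norm ?addr_ge0 ?sqr_ge0//.
apply: le_trans (normr_dotv_le _ _) _.
have := l2norm_ge0 (X k w - z); have := l2norm_ge0 (sgd_step l w).
by move: (l2norm _) (l2norm _) => u v; nra.
Qed.

(** Unbiasedness is used coordinate by coordinate; coordinates outside the block contribute zero on
    both sides. *)
Lemma integral_dotv_sampled_grad b k (y u : 'rV[R]_n) :
  (\int[mu]_z (dotv u (sampled_grad b k y z))%:E =
   (dotv u (block_proj blk b (grad (f k) y)))%:E)%E.
Proof.
have ic c : mu.-integrable setT (fun z => (u 0 c)%:E * (sampled_grad b k y z 0 c)%:E)%E.
  apply: integrableZl => //; under eq_fun do rewrite mxE.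
  case: (blk c == b); last exact: finite_measure_integrable_cst.
  by have [] := g_unbiased k y c.
under eq_integral do rewrite -sumEFin; rewrite integral_sum//.
  rewrite -sumEFin; apply: eq_bigr => c _.
  rewrite EFinM -[RHS]/(_ * _)%E.
  under eq_integral do rewrite EFinM mxE; rewrite mxE.
  case: (blk c == b); last by rewrite mule0 integral0_eq// => z _; rewrite mule0.
  have [ig] := g_unbiased k y c; rewrite unlock => <-.
  by rewrite integralZl.
Qed.

(** For [k <= l] the factor [X k] belongs to the past, so freezing leaves only the sampled gradient
    to average. *)
Lemma dotv_true_grad k l (z : 'rV[R]_n) : (k <= l)%N -> (l < M)%N ->
  P.-integrable setT (fun w => (dotv (X k w - z) (true_grad l w (X l w)))%:E) /\
  (\int[P]_w (dotv (X k w - z) (sgd_step l w))%:E =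
   \int[P]_w (dotv (X k w - z) (true_grad l w (X l w)))%:E)%E.
Proof.
move=> kl lM.
pose h (wz : g_sigma_algebraType (history l l.+1) * Xi) : \bar R :=
  (dotv (X k wz.1 - z)
     (sampled_grad (beta l wz.1) (kappa l wz.1) (X l wz.1) wz.2))%:E.
have mh : measurable_fun setT h.
  apply/measurable_EFinP; apply: measurable_dotv => c.
    under eq_fun do rewrite mxE; apply: measurable_funD => //.
    exact: (measurableT_comp (history_iterate_measurable lM c kl) measurable_fst).
  exact: history_grad_measurable.
have kM : (k <= M)%N by rewrite (leq_trans kl)// ltnW.
have mid := history_sub (ltnW lM) lM.
have [] := integral_freezing mid (zeta_measurable lM) (zeta_indep lM) mh
  (dotv_step_integrable z kM lM).
rewrite /h /=.
under eq_fun do rewrite integral_dotv_sampled_grad.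
move=> iT E; split; first exact: iT.
exact: E.
Qed.

(** The mean is exactly zero, so [c] may have either sign; it will be the negative coefficient
    [- (2 * a)]. *)
Lemma mean_noise k l c (z : 'rV[R]_n) : (k <= l)%N -> (l < M)%N ->
  mean_le P (fun w => c * dotv (X k w - z) (sgd_step l w - true_grad l w (X l w))) 0.
Proof.
move=> kl lM; have kM : (k <= M)%N by rewrite (leq_trans kl)// ltnW.
have iG := dotv_step_integrable z kM lM.
have [iD E] := dotv_true_grad z kl lM.
have eqE : (fun w => (c * dotv (X k w - z) (sgd_step l w - true_grad l w (X l w)))%:E)
  = (fun w => c%:E * ((dotv (X k w - z) (sgd_step l w))%:E -
     (dotv (X k w - z) (true_grad l w (X l w)))%:E))%E.
  by apply/funext => w; rewrite -EFinB -EFinM dotvBr.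
have iGD := integrableB measurableT iG iD.
have Dfin := integrable_fin_num measurableT iD.
split; first by have := integrableZl measurableT c iGD; rewrite -eqE.
have i0 : (\int[P]_w (c * dotv (X k w - z) (sgd_step l w - true_grad l w (X l w)))%:E
    = 0)%E.
  rewrite eqE; move: (integralZl measurableT iGD c) => /= ->.
  move: (integralB measurableT iG iD) => /= ->.
  by rewrite E (subee Dfin) mule0.
by rewrite i0.
Qed.

Lemma mean_step_norm l : (l < M)%N -> mean_le P (fun w => l2norm (sgd_step l w)) sigma.
Proof.
move=> lM; apply: mean_le_of_sqr => //.
- by apply: measurable_l2norm => c; exact: measurable_sgd_step.
- by move=> w; exact: l2norm_ge0.
- exact: second_moment.
Qed.

(** * Summing over the rounds and averaging their starting points *)

Section averaged_iterate.
Variables (m : 'I_q -> nat) (p N T : nat) (L Delta : R) (z : 'rV[R]_n).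
Hypothesis M_eq : M = (T * N)%N.
Hypotheses (a_gt0 : 0 < a) (p_gt0 : (0 < p)%N) (T_gt0 : (0 < T)%N).
Hypotheses (L_ge0 : 0 <= L) (Delta_ge0 : 0 <= Delta).
Hypothesis f_differentiable : forall k y, differentiable (f k) y.
Hypothesis f_convex : forall k, convex_function [set: 'rV[R]_n] (f k).
Hypothesis f_smooth : forall k y y',
  l2norm (grad (f k) y - grad (f k) y') <= L * l2norm (y - y').
Hypothesis round_grad : forall t w y, (t < T)%N ->
  \sum_(l < N) true_grad (t * N + l) w y = \sum_k (m k)%:R *: grad (f k) y.
Hypothesis X_bounded : forall t, (t < T)%N ->
  {ae P, forall w, l2norm (X (t * N)%N w - z) <= Delta}.
Hypothesis z_min : forall y, weighted_sum m p f z <= weighted_sum m p f y.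

Local Notation F := (weighted_sum m p f).

Definition average_iterate w := T%:R^-1 *: \sum_(t < T) X (t * N)%N w.

Lemma weighted_sum_gap y : p%:R * (F y - F z) = \sum_k (m k)%:R * (f k y - f k z).
Proof.
have p0 : p%:R != 0 :> R by rewrite pnatr_eq0 -lt0n.
rewrite mulrBr !mulr_sumr -sumrB; apply: eq_bigr => k _.
by field.
Qed.

(** The first-order convexity inequality summed with the nonnegative weights [m k]; it supplies the
    [gap] of [descent_step]. *)
Lemma weighted_sum_gap_le y :
  p%:R * (F y - F z) <= dotv (y - z) (\sum_k (m k)%:R *: grad (f k) y).
Proof.
rewrite weighted_sum_gap dotv_sumr; apply: ler_sum => k _.
rewrite dotvZr ler_wpM2l// -lerN2 opprB.
apply: le_trans (convex_grad_le z (f_convex k) (f_differentiable k y)).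
by rewrite [dotv (y - z) _]dotvC -dotvNr opprB.
Qed.

(** Jensen's inequality through supporting hyperplanes at the average: the linear terms cancel
    because the deviations sum to zero. *)
Lemma average_gap_le w : T%:R * (F (average_iterate w) - F z) <=
  \sum_(t < T) (F (X (t * N)%N w) - F z).
Proof.
have T0 : T%:R != 0 :> R by rewrite pnatr_eq0 -lt0n.
rewrite sumrB sumr_const card_ord -[F z *+ T]mulr_natl mulrBr lerD2r.
rewrite /weighted_sum exchange_big mulr_sumr; apply: ler_sum => k _ /=.
rewrite -mulr_sumr mulrCA ler_wpM2l//; set b := average_iterate w.
have H (t : 'I_T) : f k b + dotv (grad (f k) b) (X (t * N)%N w - b) <= f k (X (t * N)%N w).
  by rewrite addrC -lerBrDr convex_grad_le.
apply: le_trans (ler_sum _ (fun t _ => H t)).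
have b0 : \sum_(t < T) (X (t * N)%N w - b) = 0.
  rewrite sumrB sumr_const card_ord -scaler_nat scalerA mulfV//.
  by rewrite scale1r subrr.
by rewrite big_split/= sumr_const card_ord -dotv_sumr b0 dotv0r addr0 mulr_natl.
Qed.

Lemma measurable_gap :
  measurable_fun setT (fun w => F (average_iterate w) - F z).
Proof.
apply: measurable_funB => //; apply: measurable_sum => k.
apply: measurable_funM => //.
have mb c : measurable_fun setT (fun w => average_iterate w 0 c).
  under eq_fun do rewrite mxE summxE.
  apply: measurable_funM => //; apply: measurable_sum => t.
  by apply: measurable_X; rewrite M_eq leq_mul2r (ltnW (ltn_ord t)) orbT.
(* [f k] is viewed as a function of a point and a dummy second argument, then composed with the
   diagonal. *)
have mf := @measurable_caratheodory _ _ _ _ Omega _ _ (fun y _ => f k y) mb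
  (fun y => measurable_cst _) (fun _ y => differentiable_continuous (f_differentiable k y)).
exact: (measurableT_comp mf (measurable_fun_pair (@measurable_id _ _ _) (@measurable_id _ _ _))).
Qed.

(** The error summand of [descent_step] for step [l] of round [t]. *)
Definition round_error t l w : R :=
  - (2 * a) * dotv (X (t * N)%N w - z)
     (sgd_step (t * N + l) w - true_grad (t * N + l) w (X (t * N + l)%N w))
  + 2 * a ^+ 2 * L * Delta * \sum_(k < l) l2norm (sgd_step (t * N + k) w)
  + a ^+ 2 * N%:R * l2norm (sgd_step (t * N + l) w) ^+ 2.

Lemma round_lt t l : (t < T)%N -> (l < N)%N -> (t * N + l < M)%N.
Proof.
move=> tT lN; rewrite M_eq (@leq_trans (t.+1 * N))//.
  by rewrite mulSn addnC ltn_add2r.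
by rewrite leq_mul2r tT orbT.
Qed.

(** Pathwise telescoping of [descent_step]: the squared distance ending one round starts the
    next. *)
Lemma cumulative_descent w r : (r <= T)%N ->
  (forall t : 'I_T, l2norm (X (t * N)%N w - z) <= Delta) ->
  2 * a * (p%:R * \sum_(t < r) (F (X (t * N)%N w) - F z))
    + l2norm (X (r * N)%N w - z) ^+ 2 <=
  l2norm (x0 - z) ^+ 2 + \sum_(t < r) \sum_(l < N) round_error t l w.
Proof.
move=> + VD; elim: r => [|r IH] rT.
  by rewrite !big_ord0 !mulr0 add0r addr0 mul0n X_init.
have stepX l : (l < N)%N ->
    X (r * N + l.+1)%N w = X (r * N + l)%N w - a *: sgd_step (r * N + l) w.
  by move=> lN; rewrite addnS X_step// round_lt.
have lipD l y y' : l2norm (true_grad (r * N + l) w y - true_grad (r * N + l) w y')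
    <= L * l2norm (y - y').
  by rewrite block_projB (le_trans (l2norm_block_proj _ _ _)).
have := @descent_step _ _ _ _ (fun l => X (r * N + l)%N w)
  (fun l => sgd_step (r * N + l) w) (ltW a_gt0) stepX
  (fun l => true_grad (r * N + l) w) z L Delta
  (p%:R * (F (X (r * N)%N w) - F z)) L_ge0.
rewrite addn0 round_grad// addnC -mulSn => step.
have {}step := step (VD (Ordinal rT)) lipD (weighted_sum_gap_le _).
rewrite !big_ord_recr/= !mulrDr addrAC -addrA [leRHS]addrA.
apply: le_trans (lerD (IH (ltnW rT)) (lexx _)).
move: step; rewrite /round_error; set E := \sum_(_ < N) _ => step.
lra.
Qed.

Lemma mean_round_error t l : (t < T)%N -> (l < N)%N ->
  mean_le P (round_error t l)
    (0 + 2 * a ^+ 2 * L * Delta * (\sum_(k < l) sigma)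
       + a ^+ 2 * N%:R * sigma ^+ 2).
Proof.
move=> tT lN; have lM := round_lt tT lN.
apply: mean_leD; first apply: mean_leD.
- by apply: mean_noise => //; exact: leq_addr.
- apply: mean_leZ; first by rewrite mulr_ge0// mulr_ge0// mulr_ge0// sqr_ge0.
  apply: (mean_le_sum (h := fun k w => l2norm (sgd_step (t * N + k) w))
    (b := fun=> sigma)) => k kl.
  by apply: mean_step_norm; apply: round_lt => //; exact: ltn_trans lN.
- by apply: mean_leZ; [rewrite mulr_ge0// sqr_ge0|exact: second_moment].
Qed.

Lemma average_iterate_gap :
  (\int[P]_w (F (average_iterate w) - F z)%:E <=
   ((l2norm (x0 - z) ^+ 2 +
     T%:R * a ^+ 2 * (N%:R * sigma * (sigma + (Delta * L + sigma) * N%:R)))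
    / (2 * a * p%:R * T%:R))%:E)%E.
Proof.
have c_gt0 : 0 < 2 * a * p%:R * T%:R by rewrite !mulr_gt0 ?ltr0n.
(* [K] is the right-hand side of [cumulative_descent] at [r = T], divided by the total weight of the
   gap. *)
pose K w := (2 * a * p%:R * T%:R)^-1 * (l2norm (x0 - z) ^+ 2 +
  \sum_(t < T) \sum_(l < N) round_error t l w).
have mK : mean_le P K ((2 * a * p%:R * T%:R)^-1 * (l2norm (x0 - z) ^+ 2 +
  \sum_(t < T) \sum_(l < N) (0 + 2 * a ^+ 2 * L * Delta * (\sum_(k < l) sigma)
       + a ^+ 2 * N%:R * sigma ^+ 2))).
  apply: mean_leZ; first by rewrite invr_ge0 ltW.
  apply: mean_leD; first exact: mean_le_cst.
  apply: (mean_le_sum (h := fun t w => \sum_(l < N) round_error t l w)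
    (b := fun=> _)) => t tT.
  exact: (mean_le_sum (h := round_error t) (fun l => mean_round_error tT)).
apply: (integral_le_mean measurable_gap (k := K)).
- by move=> w; rewrite subr_ge0.
(* Finitely many almost sure bounds hold simultaneously almost surely. *)
- have : {ae P, forall w, forall t : 'I_T, l2norm (X (t * N)%N w - z) <= Delta}.
    by apply: filter_forall => t; exact: X_bounded.
  apply: filterS => w VD; rewrite /K ler_pdivlMl//.
  apply: le_trans (cumulative_descent (leqnn T) VD).
  have ap0 : 0 <= 2 * a * p%:R by rewrite mulr_ge0// mulr_ge0// ltW.
  have := ler_wpM2l ap0 (average_gap_le w).
  have := sqr_ge0 (l2norm (X (T * N)%N w - z)).
  lra.
- apply: mean_leW mK; rewrite mulrC ler_wpM2r ?invr_ge0 ?(ltW c_gt0)// lerD2l.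
  rewrite sumr_const card_ord -[_ *+ T]mulr_natl -[leRHS]mulrA ler_wpM2l//.
  (* The sum of [l] over [l < k] is at most [k ^+ 2 / 2], which absorbs the factor [2]. *)
  have drift k : \sum_(l < k) (0 + 2 * a ^+ 2 * L * Delta * (\sum_(i < l) sigma)
       + a ^+ 2 * N%:R * sigma ^+ 2) <=
      a ^+ 2 * (L * Delta * sigma * k%:R ^+ 2 + N%:R * sigma ^+ 2 * k%:R).
    elim: k => [|k IH]; first by rewrite big_ord0 expr0n/= !mulr0 addr0 mulr0.
    rewrite big_ord_recr/= sumr_const card_ord -[sigma *+ k]mulr_natl.
    rewrite mulrSr (le_trans (lerD IH (lexx _)))//.
    have := mulr_ge0 (sqr_ge0 a) (mulr_ge0 (mulr_ge0 L_ge0 Delta_ge0) sigma_ge0).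
    nra.
  apply: le_trans (drift N) _; rewrite ler_wpM2l ?sqr_ge0//.
  (* The stated bound exceeds the one from [drift] by exactly this term. *)
  have : 0 <= N%:R * sigma ^+ 2 by rewrite mulr_ge0 ?sqr_ge0.
  nra.
Qed.

End averaged_iterate.

End incremental_run.

(** * Block-SMOO as an incremental run *)

(** Order of step numbers becomes lexicographic order of quotient and remainder, the order in which
    [smoo_past] is phrased. *)
Lemma divn_modn_lex k l e : (k < l)%N ->
  (k %/ e < l %/ e)%N \/ (k %/ e = l %/ e)%N /\ (k %% e < l %% e)%N.
Proof.
move=> kl; have := leq_div2r e (ltnW kl).
rewrite leq_eqVlt => /predU1P[E|]; last by left.
by right; split=> //; move: kl; rewrite {1}(divn_eq k e) {1}(divn_eq l e) E ltn_add2l.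
Qed.

(** The carry case: before a multiple of [e] the last digit is maximal. *)
Lemma dvdn_succ_modn l e : (0 < e)%N -> (e %| l.+1)%N -> ((l %% e).+1 = e)%N.
Proof.
move=> e0 dv; apply/eqP; rewrite eqn_leq ltn_mod e0/= dvdn_leq//.
by rewrite {1}(divn_eq l e) -addnS dvdn_addr ?dvdn_mull in dv.
Qed.

Lemma modn_block t k s p : (0 < p)%N -> (k < s * p)%N ->
  [/\ ((t * (s * p) + k) %/ p %/ s = t)%N,
      ((t * (s * p) + k) %/ p %% s = k %/ p)%N &
      ((t * (s * p) + k) %% p = k %% p)%N].
Proof.
move=> p0 k_lt; have ks : (k %/ p < s)%N by rewrite ltn_divLR.
have s0 : (0 < s)%N by exact: leq_ltn_trans ks.
rewrite mulnA modnMDl divnMDl// divnMDl// modnMDl.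
by rewrite divn_small// modn_small// addn0.
Qed.

Lemma sum_nat_block (V : zmodType) (F : nat -> V) s p :
  \sum_(l < s * p) F l = \sum_(i < s) \sum_(j < p) F (i * p + j)%N.
Proof.
rewrite -(big_mkord xpredT F) big_nat_mul big_mkord; apply: eq_bigr => i _.
rewrite -{1}[(i * p)%N]add0n mulSn big_addn addnK big_mkord.
by apply: eq_bigr => j _; rewrite addnC.
Qed.

Lemma measurable_fin_comp d (D : measurableType d) (K : finType) (J : Type)
    (h : D -> K) (phi : K -> J) j :
  (forall u, measurable [set w | h w = u]) ->
  measurable ((fun w => phi (h w)) @^-1` [set j]).
Proof.
move=> mh; rewrite (_ : _ @^-1` _ =
    \bigcup_(u in [set u | phi u = j]) [set w | h w = u]).
  by apply: fin_bigcup_measurable => [|u _]; [exact: finite_finset|exact: mh].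
by apply/seteqP; split => [w /= <-|w /= [u /= <- <-]//]; exists (h w).
Qed.

Lemma block_proj_sum (R : realType) n s (blk : 'I_n -> 'I_s) b I (r : seq I)
    (v : I -> 'rV[R]_n) :
  block_proj blk b (\sum_(i <- r) v i) = \sum_(i <- r) block_proj blk b (v i).
Proof.
apply/rowP => c; rewrite mxE !summxE.
under [RHS]eq_bigr do rewrite mxE.
by case: (blk c == b) => //; rewrite big1.
Qed.

(** Group the steps [j] by the value [v j]. *)
Lemma sum_frequency (W : zmodType) (q p : nat)
    (v : 'I_p -> 'I_q) (m : 'I_q -> nat) (F : 'I_q -> W) :
  (forall k, #|[set j | v j == k]%SET| = m k) ->
  \sum_j F (v j) = \sum_k F k *+ m k.
Proof.
move=> vm; rewrite (partition_big v xpredT)//=; apply: eq_bigr => k _.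
rewrite (eq_bigr (fun=> F k)); last by move=> j /eqP->.
by rewrite sumr_const -(vm k); congr (_ *+ _); apply: eq_card => j; rewrite inE.
Qed.

Theorem theorem3p2
  (R : realType) (d d' : measure_display)
  (Omega : measurableType d) (P : probability Omega R)
  (Xi : measurableType d') (mu : probability Xi R)
  (n s q : nat) (hs : (1 <= s)%N)
  (blk : 'I_n -> 'I_s)
  (f : 'I_q -> 'rV[R]_n -> R) (g : 'I_q -> 'rV[R]_n -> Xi -> R)
  (m : 'I_q -> nat) (p : nat) (hp : p = (\sum_k m k)%N) (hp1 : (1 <= p)%N)
  (f_C1 : forall k, continuously_differentiable (f k))
  (g_expectation : forall k y,
     mu.-integrable [set: Xi] (fun z => (g k y z)%:E) /\
     ((f k y)%:E = 'E_mu[fun z => g k y z])%E)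
  (g_differentiable : forall k z y, differentiable (fun y' => g k y' z) y)
  (* (1) *)
  (L : R) (L_gt0 : 0 < L)
  (f_smooth : forall k y y',
     l2norm (grad (f k) y - grad (f k) y') <= L * l2norm (y - y'))
  (F_bounded_below : has_lbound (range (weighted_sum m p f)))
  (* (2) *)
  (sigma : R) (sigma_ge0 : 0 <= sigma)
  (g_unbiased : forall k y,
     has_vector_expectation mu (fun z => grad (fun y' => g k y' z) y)
       (grad (f k) y))
  (g_bounded : forall k y,
     ('E_mu[fun z => (l2norm (grad (fun y' => g k y' z) y) ^+ 2)%R]
        <= (sigma ^+ 2)%:E)%E)
  (* the run of the algorithm *)
  (T : nat) (hT : (1 <= T)%N) (x0 : 'rV[R]_n)
  (tau : nat -> Omega -> 'S_s)
  (pi : nat -> 'I_s -> Omega -> {ffun 'I_p -> 'I_q})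
  (xi : nat -> 'I_s -> 'I_p -> {RV P >-> Xi})
  (x : nat -> nat -> nat -> Omega -> 'rV[R]_n)
  (samples : fresh_samples mu T tau pi xi)
  (run : block_smoo_run blk m g T (fun _ => 1 / Num.sqrt T%:R) x0 tau pi xi x)
  (* (3) *)
  (f_convex : forall k, convex_function [set: 'rV[R]_n] (f k))
  (xstar : 'rV[R]_n)
  (xstar_min : forall y, weighted_sum m p f xstar <= weighted_sum m p f y)
  (Delta : R)
  (x_bounded : forall t, (t < T)%N ->
     {ae P, forall w, l2norm (x t 0%N 0%N w - xstar) <= Delta}) :
  let F := weighted_sum m p f in
  let Fstar := inf (range F) in
  let xbar := fun w => T%:R^-1 *: \sum_(t < T) x t 0%N 0%N w in
  ('E_P[fun w => (F (xbar w) - Fstar)%R] <=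
   ((l2norm (x0 - xstar) ^+ 2 +
     s%:R * p%:R * sigma *
       (sigma + (Delta * L + sigma) * (s%:R * p%:R)))
    / (2 * p%:R * Num.sqrt T%:R))%:E)%E.
Proof.
cbv zeta; set F := weighted_sum m p f; set Fstar := inf (range F).
have p_gt0 : (0 < p)%N by [].
have s_gt0 : (0 < s)%N by [].
(* [io] and [jo] turn numbers into ordinals, with default [0] out of range; only in-range arguments
   occur below. *)
pose io k : 'I_s := insubd (Ordinal hs) k.
pose jo k : 'I_p := insubd (Ordinal hp1) k.
have ioE k : (k < s)%N -> io k = k :> nat by move=> ks; rewrite val_insubd ks.
have joE k : (k < p)%N -> jo k = k :> nat by move=> kp; rewrite val_insubd kp.
pose N := (s * p)%N; pose M := (T * N)%N.
(* Mixed-radix digits of the step number [l]: outer iteration, block round, inner step. *)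
pose st l := (l %/ p %/ s)%N; pose si l := (l %/ p %% s)%N; pose sj l := (l %% p)%N.
have si_lt l : (si l < s)%N by rewrite ltn_mod.
have sj_lt l : (sj l < p)%N by rewrite ltn_mod.
have st_lt l : (l < M)%N -> (st l < T)%N.
  by move=> lM; rewrite /st -divnMA [(p * s)%N]mulnC ltn_divLR// muln_gt0 s_gt0.
pose beta l w := tau (st l) w (io (si l)).
pose kappa l w : 'I_q := pi (st l) (io (si l)) w (jo (sj l)).
pose zeta l : Omega -> Xi := xi (st l) (io (si l)) (jo (sj l)).
pose X l w := x (st l) (si l) (sj l) w.
pose a : R := 1 / Num.sqrt T%:R.
have T0 : 0 < T%:R :> R by rewrite ltr0n.
have sqT0 : 0 < Num.sqrt T%:R :> R by rewrite sqrtr_gt0.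
have a_gt0 : 0 < a by rewrite divr_gt0.
have X_init w : X 0%N w = x0.
  by rewrite /X /st /si /sj !div0n !mod0n (run_init run).
have X_step l w : (l < M)%N ->
    X l.+1 w = X l w - a *: sgd_step blk g beta kappa zeta X l w.
  move=> lM; have tT := st_lt _ lM.
  have := run_step run (io (si l)) (jo (sj l)) w tT.
  rewrite ioE// joE// => step.
  transitivity (x (st l) (si l) (sj l).+1 w); last exact: step.
  rewrite /X /st /si /sj.
  (* A carry out of the last digit ends a block, and a further carry ends the outer iteration; these
     match [run_next_block] and [run_next_iter]. *)
  have [dv|ndv] := boolP (p %| l.+1)%N; last first.
    by rewrite divnS// (negbTE ndv) add0n modnS (negbTE ndv).
  rewrite (dvdn_succ_modn p_gt0 dv) divnS// dv add1n [(l.+1 %% p)%N]modnS dv.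
  have := run_next_block run (io (si l)) w tT; rewrite ioE// => <-.
  rewrite /si; have [dvs|ndvs] := boolP (s %| (l %/ p).+1)%N; last first.
    by rewrite divnS// (negbTE ndvs) add0n modnS (negbTE ndvs).
  rewrite (dvdn_succ_modn s_gt0 dvs) divnS// dvs add1n modnS dvs.
  exact: (run_next_iter run w tT).
have X_round t w : X (t * N)%N w = x t 0%N 0%N w.
  have [|h1 h2 h3] := @modn_block t 0 s p p_gt0; first by rewrite muln_gt0 s_gt0.
  move: h1 h2 h3; rewrite addn0 div0n mod0n => h1 h2 h3.
  by rewrite /X /st /si /sj h1 h2 h3.
(* Were [Delta] negative, a null set containing every failure of the bound at [t = 0] would be the
   whole space, of probability one. *)
have Delta_ge0 : 0 <= Delta.
  have [N0 [mN0 PN0 subN0]] := x_bounded 0%N hT.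
  have [//|Delta_lt0] := leP 0 Delta.
  have : (P setT <= P N0)%E.
    apply: le_measure; rewrite ?inE// => w _; apply: subN0 => /=.
    by move=> h; have := le_lt_trans h Delta_lt0; rewrite ltNge l2norm_ge0.
  by rewrite PN0 probability_setT lee_fin ler10.
have FstarE : Fstar = F xstar.
  apply/eqP; rewrite eq_le; apply/andP; split.
    by apply: ge_inf => //; exists xstar.
  by apply: lb_le_inf; [exists (F xstar), xstar|move=> _ [y _ <-]; exact: xstar_min].
have beta_meas l i : (l < M)%N -> measurable (beta l @^-1` [set i]).
  move=> lM; apply: (measurable_fin_comp (fun u : 'S_s => u (io (si l)))) => u.
  exact: (tau_measurable samples u (st_lt _ lM)).
have kappa_meas l i : (l < M)%N -> measurable (kappa l @^-1` [set i]).
  move=> lM; apply: (measurable_fin_comp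
    ((fun v : {ffun 'I_p -> 'I_q} => v (jo (sj l))))) => v.
  exact: (pi_measurable samples _ v (st_lt _ lM)).
have zeta_meas l : (l < M)%N -> measurable_fun setT (zeta l).
  by move=> lM; exact: measurable_funPT.
(* All steps of a block share its choices, so for them only outer iteration and block round are
   compared, equality included. *)
have lex k l : (k <= l)%N -> (st k < st l)%N \/ st k = st l /\ (si k <= si l)%N.
  move=> kl; have := leq_div2r p kl; rewrite leq_eqVlt => /predU1P[E|].
    by right; rewrite /st /si E.
  by move/(divn_modn_lex s) => [|[E /ltnW le_si]]; [left|right].
(* Independence thus passes from the past of the algorithm to the history of the run; a single
   chosen block or objective is a function of the whole [tau] or [pi], handled by finite unions. *)
have past_sub l : (l < M)%N -> <<s history beta kappa zeta l l.+1 >> `<=`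
    <<s smoo_past tau pi xi (st l) (io (si l)) (jo (sj l)) >>.
  move=> lM; apply: smallest_sub; first exact: smallest_sigma_algebra.
  move=> A [[[k [B [kl mB ->]]]|[k [i [kl ->]]]]|[k [i [kl ->]]]].
  - apply: sub_sigma_algebra; left; left.
    exists (st k), (io (si k)), (jo (sj k)), B; split => //.
    have [|[E lt_sj]] := divn_modn_lex p kl; last first.
      by apply: Or33; rewrite /st /si E !joE.
    move=> /(divn_modn_lex s) [|[E lt_si]]; first by move=> ?; apply: Or31.
    by apply: Or32; rewrite !ioE.
  - apply: (@measurable_fin_comp _ (g_sigma_algebraType
      (smoo_past tau pi xi (st l) (io (si l)) (jo (sj l)))) _ _ (tau (st k))
      (fun u : 'S_s => u (io (si k)))) => u.
    apply: sub_sigma_algebra; left; right; exists (st k), u; split => //.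
    by have [/ltnW//|[->]] := lex _ _ (kl : (k <= l)%N).
  - apply: (@measurable_fin_comp _ (g_sigma_algebraType
      (smoo_past tau pi xi (st l) (io (si l)) (jo (sj l)))) _ _
      (pi (st k) (io (si k)))
      (fun v : {ffun 'I_p -> 'I_q} => v (jo (sj k)))) => v.
    apply: sub_sigma_algebra; right; exists (st k), (io (si k)), v; split => //.
    by rewrite !ioE//; exact: lex (kl : (k <= l)%N).
have zeta_indep l : (l < M)%N -> independent_with_law P mu
    (id : Omega -> g_sigma_algebraType (history beta kappa zeta l l.+1)) (zeta l).
  move=> lM A B mA mB.
  rewrite -(sample_law samples (io (si l)) (jo (sj l)) (st_lt _ lM) mB).
  have := sample_indep samples (i := io (si l)) (j := jo (sj l)) (st_lt _ lM).
  by move/(_ A B (past_sub _ lM _ mA) mB).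
have round t w y : (t < T)%N -> \sum_(l < N) true_grad blk f beta kappa (t * N + l) w y =
    \sum_k (m k)%:R *: grad (f k) y.
  move=> tT.
  rewrite (sum_nat_block (fun l => true_grad blk f beta kappa (t * N + l) w y)).
  (* The full gradient is split over the blocks in the order of visit; within each block the
     frequencies [m k] count the objectives. *)
  rewrite -[RHS](sum_block_proj blk (tau t w)); apply: eq_bigr => i _.
  transitivity (block_proj blk (tau t w i) (\sum_j grad (f (pi t i w j)) y)).
    rewrite block_proj_sum; apply: eq_bigr => j _.
    have ij_lt : (i * p + j < s * p)%N.
      rewrite (@leq_trans (i.+1 * p))//; last by rewrite leq_mul2r ltn_ord orbT.
      by rewrite mulSn addnC ltn_add2r.
    have [h1 h2 h3] := modn_block t p_gt0 ij_lt.
    rewrite /true_grad /beta /kappa /st /si /sj h1 h2 h3.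
    rewrite divnMDl// divn_small// addn0 modnMDl modn_small//.
    have -> : io i = i by apply: val_inj; rewrite /= ioE.
    by have -> : jo j = j by apply: val_inj; rewrite /= joE.
  congr block_proj; rewrite (sum_frequency (fun k => grad (f k) y)
    (fun k => run_freq run i w k tT)).
  by apply: eq_bigr => k _; rewrite scaler_nat.
have bounded t : (t < T)%N ->
    {ae P, forall w, l2norm (X (t * N)%N w - xstar) <= Delta}.
  by move=> tT; apply: filterS (x_bounded t tT) => w; rewrite X_round.
have g_meas k y : measurable_fun setT (g k y).
  by have [/measurable_int/measurable_EFinP] := g_expectation k y.
have := @average_iterate_gap R d d' Omega P Xi mu n s q blk f g a sigma x0
  beta kappa zeta X M g_meas g_differentiable sigma_ge0 g_unbiased g_bounded X_init
  X_step beta_meas kappa_meas zeta_meas zeta_indep m p N T L Delta xstar erefl a_gt0 p_gt0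
  hT (ltW L_gt0) Delta_ge0 (fun k => (f_C1 k).1) f_convex f_smooth round bounded xstar_min.
rewrite FstarE unlock /average_iterate.
under eq_integral do under eq_bigr do rewrite X_round.
move=> /le_trans; apply; rewrite lee_fin.
have sqT2 : Num.sqrt T%:R ^+ 2 = T%:R :> R by rewrite sqr_sqrtr// ltW.
(* The step size [1 / Num.sqrt T%:R] makes the accumulated error independent of [T] and leaves
   [Num.sqrt T%:R] in the denominator. *)
have -> : T%:R * a ^+ 2 = 1 by rewrite /a expr_div_n expr1n sqT2 mulrC divfK// gt_eqF.
have -> : 2 * a * p%:R * T%:R = 2 * p%:R * Num.sqrt T%:R.
  by rewrite /a -{2}sqT2; field; rewrite gt_eqF.
by rewrite mul1r /N natrM.
Qed.
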